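(* Let $k$ be an algebraically closed field of characteristic $p>0$ and let $X\subset\mathbb P^3_k$ be a smooth extremal surface. The automorphism group $\operatorname{Aut}(X)$ acts transitively on the set of stars of $X$.
   Context: $k$ is an algebraically closed field of characteristic $p>0$. A Frobenius form is a homogeneous polynomial of degree $q+1$, where $q=p^e$ for some $e\ge 1$, of the form $\sum_i x_i^{q}L_i$ with each $L_i$ a linear form. An extremal surface of degree $q+1$ is a surface in $\mathbb P^3_k$ defined by a Frobenius form of degree $q+1$ in four variables. Automorphisms are projective linear: $\operatorname{Aut}(X)$ is the subgroup of $\operatorname{PGL}(4,k)$ preserving $X$. A star on a smooth surface $X\subset\mathbb P^3$ of degree $d$ is a configuration of $d$ (distinct) lines on $X$ all meeting at one point. *)

(* Defs.v *)
From HB Require Import structures.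
From mathcomp Require Import all_boot all_order all_algebra.
From mathcomp Require Import finmap mpoly.

Set Implicit Arguments.
Unset Strict Implicit.
Unset Printing Implicit Defensive.

Import GRing.Theory.
Local Open Scope ring_scope.

(* Linear subspaces of P^3 are encoded by the linear subspaces of k^4 (row    *)
(* vectors) of vector dimension one more: points have dimension 1, lines 2.   *)

Section ExtremalSurface.
Variable k : fieldType.
Implicit Types (F : {mpoly k[4]}) (U P : {vspace 'rV[k]_4}).
Implicit Types (A : 'M[k]_4) (S : {fset {vspace 'rV[k]_4}}).

Definition Frobenius_form (q : nat) F : Prop :=
  exists L : 'I_4 -> {mpoly k[4]},
    (forall i, L i \is 1.-homog) /\ F = \sum_(i < 4) 'X_i ^+ q * L i.

Definition is_point P : Prop := \dim P = 1%N.
Definition is_line U : Prop := \dim U = 2%N.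

(* P(U) is contained in the surface F = 0.                                    *)
Definition on_surface F U : Prop := forall v, v \in U -> F.@[v 0] = 0.

(* Jacobian criterion; it excludes F = 0.                                     *)
Definition smooth_surface F : Prop :=
  forall v : 'rV[k]_4, v != 0 -> F.@[v 0] = 0 ->
    exists i : 'I_4, F^`M(i).@[v 0] != 0.

(* Elements of PGL(4, k) are given by representatives A in GL(4, k), acting   *)
(* on the right of row vectors; the action on subspaces is unchanged when A   *)
(* is multiplied by a nonzero scalar.                                         *)
Definition proj_act A U : {vspace 'rV[k]_4} := (linfun (mulmxr A) @: U)%VS.

Definition surface_aut F A : Prop :=
  A \in unitmx /\
  forall P, is_point P -> (on_surface F (proj_act A P) <-> on_surface F P).

Definition is_star (d : nat) F S : Prop :=
  [/\ #|` S|%fset = d,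
      forall U, U \in S -> is_line U /\ on_surface F U &
      exists P, is_point P /\ forall U, U \in S -> (P <= U)%VS].

Definition star_act A S : {fset {vspace 'rV[k]_4}} :=
  [fset proj_act A U | U in S]%fset.

End ExtremalSurface.

(* Main.v *)
(* A Frobenius form is F(x) = B(x, x) with B(x, y) = x^(q) M y^T, and F is     *)
(* smooth iff M is invertible.  Then B(x, phi y) = B(y, x)^q for a bijective   *)
(* q^2-semilinear map phi.  If v spans the centre of a star, two of its lines  *)
(* span the hyperplane B(v, -) = 0 = B(-, v), which forces phi v to be         *)
(* proportional to v; after rescaling phi v = v.  Solving phi t - t = u, as in *)
(* Lang's theorem, inside that hyperplane completes v to a hyperbolic pair of  *)
(* phi-fixed vectors; repeating this in the orthogonal complement gives a      *)
(* basis starting at v in which B is the sum of two hyperbolic planes.  In     *)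
(* this basis F = x0^q x1 + x0 x1^q + x2^q x3 + x2 x3^q, so exactly q + 1      *)
(* lines of the surface pass through v, the star consists of all of them, and  *)
(* the change of basis between two such bases maps one star to the other.      *)

Require Import Defs.
From HB Require Import structures.
From mathcomp Require Import all_boot all_order all_algebra.
From mathcomp Require Import finmap mpoly ring.

Set Implicit Arguments.
Unset Strict Implicit.
Unset Printing Implicit Defensive.

Import GRing.Theory.
Local Open Scope ring_scope.

(** The semilinear map phi above is [twist]. A frame is a basis in which [frob_form M] has the Gram
    matrix [frame_form]. Any two frames have the same Gram matrix, so the change of basis between
    them preserves [frob_form M] and hence the surface. By [star_linesP] every star is the explicit
    list [star_lines] of some frame. The centre is an eigenvector of [twist] by [star_center_twist],
    and [exists_frame] extends a fixed multiple of it to a frame, using [lang_surjective] through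
    [hyperbolic_partner]. *)

(** * Semilinear equations over an algebraically closed field *)

Lemma iter_dependent (K : fieldType) (V : vectType K) (phi : V -> V) (u : V) :
  exists m, exists a : 'I_m -> K,
    iter m phi u = \sum_(i < m) a i *: iter i phi u.
Proof.
pose X m := mkseq (fun i => iter i phi u) m.
suff [m /andP[_ mX]] : exists m, (m <= \dim {:V})%N && (iter m phi u \in <<X m>>%VS).
  exists m; pose t : m.-tuple V :=
    Tuple (introT eqP (size_mkseq (fun i => iter i phi u) m)).
  exists (fun i => coord t i (iter m phi u)).
  rewrite {1}(coord_span (X := t) mX); apply: eq_bigr => i _.
  by rewrite /= nth_mkseq.
case: (pickP (fun m : 'I_(\dim {:V}).+1 => iter m phi u \in <<X m>>%VS)).
  by move=> m hm; exists m; rewrite -ltnS ltn_ord.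
(* If no such [m] existed, the first [(\dim {:V}).+1] iterates would be free, which is one vector
   too many. *)
move=> nX; have fX m : (m <= (\dim {:V}).+1)%N -> free (X m).
  elim: m => [|m IH] hm; first exact: nil_free.
  rewrite /X mkseqS (perm_free (permEl (perm_rcons _ _))).
  by rewrite free_cons IH ?(ltnW hm) // (nX (Ordinal hm)).
have /eqP dX := fX _ (leqnn _).
by have := dimvS (subvf <<X (\dim {:V}).+1>>%VS); rewrite dX size_mkseq ltnn.
Qed.

(** Only nonzero constants lack a root, and their derivative is 0, not -1. *)
Lemma separable_root (K : closedFieldType) (P : {poly K}) :
  P^`() = -1 -> exists x, root P x.
Proof.
move=> dP; apply/closed_rootP; apply/eqP => /eqP/size_poly1P[c _ Pc].
by move/eqP: dP; rewrite Pc derivC eq_sym oppr_eq0 oner_eq0.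
Qed.

Lemma deriv_exp_pchar (K : fieldType) (Q : nat) (P : {poly K}) :
  Q%:R = 0 :> K -> (P ^+ Q)^`() = 0.
Proof.
move=> Q0; rewrite deriv_exp -mulr_natr.
by rewrite -polyC_natr Q0 polyC0 mulr0.
Qed.

(* Look for [t] in the span of the iterates of [phi] at [u]: all coefficients  *)
(* are polynomials in the last one, which is then a root of a polynomial of    *)
(* derivative [-1].                                                            *)
Lemma lang_surjective (K : closedFieldType) (V : vectType K) (Q : nat)
    (phi : V -> V) (P : V -> Prop) (u : V) :
    Q%:R = 0 :> K ->
    {morph phi : x y / x + y} -> (forall c x, phi (c *: x) = c ^+ Q *: phi x) ->
    P 0 -> (forall c x y, P x -> P y -> P (c *: x + y)) ->
    (forall x, P x -> P (phi x)) ->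
  P u -> exists2 t, P t & phi t = t + u.
Proof.
move=> Q0 phiD phiZ P0 PZD Pphi Pu.
have phi0 : phi 0 = 0 by apply: (addrI (phi 0)); rewrite -phiD !addr0.
have phi_sum n (F : 'I_n -> V) : phi (\sum_(i < n) F i) = \sum_(i < n) phi (F i).
  exact: (big_morph phi phiD phi0).
have Psum n (c : 'I_n -> K) : P (\sum_(i < n) c i *: iter i phi u).
  elim/big_rec: _ => // i x _; apply: PZD.
  by elim: (i : nat) => //= j; apply: Pphi.
have [[|n] [a Da]] := iter_dependent phi u.
  by exists 0 => //; move: Da; rewrite big_ord0 /= phi0 add0r.
(* [b] extends [a] by 0 to all naturals, so that [c] can be defined by plain recursion. *)
pose b i := if insub i is Some j then a j else 0.
have bE (i : 'I_n.+1) : b i = a i by rewrite /b valK.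
(* [c i] is the coefficient of [iter i phi u] in [t], as a polynomial in the last coefficient. The
   recursion compares coefficients in [phi t = t + u]; the -1 at index 0 accounts for [u]. *)
pose c := fix c i : {poly K} :=
  (if i is j.+1 then c j ^+ Q else -1) + (b i)%:P * 'X ^+ Q.
have dc i : (c i)^`() = 0.
  by case: i => [|i] /=; rewrite derivD derivM derivC deriv_exp_pchar // ?derivN
    ?deriv_exp_pchar // ?derivC mul0r mulr0 ?oppr0 !addr0.
have [|tau] := @separable_root _ (c n - 'X).
  by rewrite derivB dc derivX sub0r.
rewrite /root !hornerE subr_eq0 => /eqP Dtau.
exists (\sum_(i < n.+1) (c i).[tau] *: iter i phi u); first exact: Psum.
have -> : phi (\sum_(i < n.+1) (c i).[tau] *: iter i phi u) =
    \sum_(i < n) (c i).[tau] ^+ Q *: iter i.+1 phi u + tau ^+ Q *: iter n.+1 phi u.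
  by rewrite phi_sum big_ord_recr /= phiZ Dtau; congr (_ + _);
    apply: eq_bigr => i _; rewrite phiZ.
have cE i : (c i).[tau] =
    (if i is j.+1 then (c j).[tau] ^+ Q else -1) + b i * tau ^+ Q.
  by case: i => [|i] /=; rewrite !hornerE.
under [in RHS]eq_bigr => i _ do rewrite cE scalerDl bE mulrC -scalerA.
rewrite big_split /= -scaler_sumr -Da [in RHS]big_ord_recl /= scaleN1r.
by rewrite [RHS]addrC !addrA subrr add0r.
Qed.

(** * Lines, Frobenius powers and linear forms *)

Lemma line_span (K : fieldType) (U : {vspace 'rV[K]_4}) (v : 'rV[K]_4) :
    is_line U -> v != 0 -> v \in U ->
  exists2 u, u \notin <[v]>%VS & U = (<[v]> + <[u]>)%VS.
Proof.
move=> dU v0 vU.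
have /subvPn[u uU uv] : ~~ (U <= <[v]>)%VS.
  by apply/negP => /dimvS; rewrite dU dim_vline v0.
exists u => //; apply/esym/eqP; rewrite eqEdim subv_add -!memvE vU uU dU /=.
have : free [:: u; v] by rewrite free_cons span_seq1 uv seq1_free.
by rewrite /free span_cons span_seq1 addvC => /eqP->.
Qed.

Lemma addv_line_shift (K : fieldType) (V : vectType K) (v z : V) (a c : K) :
  c != 0 -> (<[v]> + <[a *: v + c *: z]> = <[v]> + <[z]>)%VS.
Proof.
move=> c0; apply/eqP; rewrite eqEsubv !subv_add !addvSl /= -!memvE.
rewrite memv_add ?memvZ ?memv_line //=.
have {1}-> : z = - (a / c) *: v + c^-1 *: (a *: v + c *: z).
  by rewrite scalerDr !scalerA mulVf // scale1r addrA -scalerDl mulrC addNr scale0r add0r.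
by rewrite memv_add ?memvZ ?memv_line.
Qed.

Lemma frobenius_rmorphism (R : comNzRingType) (p e : nat) : p \in [pchar R] ->
  exists f : {rmorphism R -> R}, forall x, f x = x ^+ (p ^ e).
Proof.
move=> hp; elim: e => [|e [f fE]]; first by exists idfun => x; rewrite expn0 expr1.
exists (f \o pFrobenius_aut hp) => x.
by rewrite /= fE pFrobenius_autE -exprM expnS.
Qed.

(** The roots are listed with multiplicity, which bounds the number of lines through a point;
    distinctness comes from the star itself in [star_linesP]. *)
Lemma roots_XnDX (K : closedFieldType) (q : nat) : (1 < q)%N ->
  exists2 rs : seq K, size rs = q & forall r, r ^+ q + r = 0 -> r \in rs.
Proof.
move=> q_gt1; pose P : {poly K} := 'X^q + 'X.
have sP : size P = q.+1 by rewrite size_polyDl size_polyXn // size_polyX ltnS.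
have P0 : lead_coef P != 0 by rewrite lead_coef_eq0 -size_poly_eq0 sP.
have [rs DP] := closed_field_poly_normal P.
exists rs; first by move: sP; rewrite DP size_scale // size_prod_XsubC => -[].
move=> r r0; rewrite -root_prod_XsubC -(rootZ _ _ P0) -DP.
by rewrite /root !hornerE r0.
Qed.

Lemma homog1E (n : nat) (R : nzRingType) (L : {mpoly R[n]}) : L \is 1.-homog ->
  L = \sum_j L@_U_(j) *: 'X_j.
Proof.
move=> hL; apply/mpolyP => m; rewrite raddf_sum /=.
under eq_bigr => j _ do rewrite mcoeffZ mcoeffX.
have [/mdeg1P[i /eqP->]|m1] := boolP (mdeg m == 1%N).
  rewrite (bigD1 i) //= eqxx mulr1 big1 ?addr0 // => j ji.
  by rewrite eq_mnm1 (negPf ji) mulr0.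
rewrite (dhomog_nemf_coeff hL) // big1 // => j _.
by case: (U_(j)%MM =P m) m1 => [<-|_ _]; rewrite ?mdeg1 ?mulr0.
Qed.

Lemma mderiv_homog1 (n : nat) (R : nzRingType) (L : {mpoly R[n]}) (j : 'I_n) :
  L \is 1.-homog -> L^`M(j) = (L@_U_(j))%:MP.
Proof.
move=> hL; apply/mpolyP => m; rewrite mcoeff_deriv mcoeffC.
have [->|m0] := eqVneq m 0%MM; first by rewrite mnm0E add0m mulr1.
rewrite (dhomog_nemf_coeff hL) ?mul0rn ?mulr0 //.
by rewrite /= mdegD mdeg1 addn1 eqSS mdeg_eq0.
Qed.

Lemma nth_root_exists (K : closedFieldType) (n : nat) (a : K) :
  (0 < n)%N -> exists x, x ^+ n = a.
Proof.
case: n => // n _.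
have [x xn] := @solve_monicpoly K n.+1 (fun i => if i is 0%N then a else 0) isT.
exists x; rewrite xn big_ord_recl expr0 mulr1 big1 ?addr0 // => i _.
by rewrite mul0r.
Qed.

(** * The Frobenius form and its adjoint semilinear map *)

Section FrobeniusForm.
Variables (K : closedFieldType) (q : nat) (f : {rmorphism K -> K}).
Hypotheses (fE : forall x, f x = x ^+ q) (q_gt1 : (1 < q)%N) (q0 : q%:R = 0 :> K).

Definition frob_form n (M : 'M[K]_n) (x y : 'rV[K]_n) : K :=
  (map_mx f x *m M *m y^T) 0 0.

(* The [q ^ 2]-semilinear map adjoint to [frob_form M]; see [form_twist]. *)
Definition twist n (M : 'M[K]_n) (y : 'rV[K]_n) : 'rV[K]_n :=
  map_mx f (map_mx f y *m M) *m invmx M^T.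

Section Form.
Variables (n : nat) (M : 'M[K]_n).
Local Notation B := (frob_form M).
Implicit Types x y z : 'rV[K]_n.

Lemma formDl x y z : B (x + y) z = B x z + B y z.
Proof. by rewrite /frob_form map_mxD !mulmxDl mxE. Qed.

Lemma formZl c x y : B (c *: x) y = f c * B x y.
Proof. by rewrite /frob_form map_mxZ -!scalemxAl mxE. Qed.

Lemma formDr x y z : B x (y + z) = B x y + B x z.
Proof. by rewrite /frob_form linearD mulmxDr mxE. Qed.

Lemma formZr c x y : B x (c *: y) = c * B x y.
Proof. by rewrite /frob_form linearZ -scalemxAr mxE. Qed.

Lemma form0r x : B x 0 = 0.
Proof. by rewrite -(scale0r 0) formZr mul0r. Qed.

Lemma form0l x : B 0 x = 0.
Proof. by rewrite -(scale0r 0) formZl rmorph0 mul0r. Qed.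

Definition formE := (formDl, formZl, formDr, formZr, form0r, form0l).

Lemma twistD : {morph twist M : x y / x + y}.
Proof. by move=> x y; rewrite /twist map_mxD mulmxDl map_mxD mulmxDl. Qed.

Lemma twistZ c x : twist M (c *: x) = c ^+ (q * q) *: twist M x.
Proof.
by rewrite /twist map_mxZ -scalemxAl map_mxZ -scalemxAl /= !fE -exprM.
Qed.

Hypothesis Mu : M \in unitmx.

Lemma form_twist x y : B x (twist M y) = f (B y x).
Proof.
rewrite /frob_form /twist trmx_mul trmx_inv trmxK mulmxA mulmxK //.
rewrite map_trmx -map_mxM mxE; congr (f _).
by rewrite -[x *m _]trmxK trmx_mul trmxK mxE.
Qed.

Lemma form_nondegenerate x : x != 0 -> exists y, B x y != 0.
Proof.
move=> x0; have : map_mx f x *m M != 0.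
  apply: contraNneq x0 => xM0; rewrite -(map_mx_eq0 f).
  by rewrite -[map_mx _ _](mulmxK Mu) xM0 mul0mx.
case/rV0Pn=> j xj; exists (delta_mx 0 j).
by rewrite /frob_form trmx_delta -colE mxE.
Qed.

Lemma twist_eq0 x : twist M x = 0 -> x = 0.
Proof.
move=> tx; apply/eqP; apply: contraT => /form_nondegenerate[y].
by rewrite -(fmorph_eq0 f) -form_twist tx form0r eqxx.
Qed.

(** By semilinearity, [a] must satisfy [a ^+ (q * q).-1 = c^-1]. *)
Lemma twist_fixed_scale x c : x != 0 -> twist M x = c *: x ->
  exists2 a, a != 0 & twist M (a *: x) = a *: x.
Proof.
move=> x0 tx; have c0 : c != 0.
  by apply: contraNneq x0 => c0; apply/eqP/twist_eq0; rewrite tx c0 scale0r.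
have [|a Da] := @nth_root_exists K (q * q).-1 c^-1.
  by case: q q_gt1 => [|[]].
have a0 : a != 0.
  by apply: contraNneq c0 => a0; rewrite -invr_eq0 -Da a0 expr0n; case: q q_gt1 => [|[]].
exists a => //; rewrite twistZ tx scalerA.
rewrite -(@prednK (q * q)) ?muln_gt0 ?(ltnW q_gt1) // exprS Da.
by rewrite -mulrA mulVf ?mulr1.
Qed.

(** Against a fixed vector, left and right orthogonality coincide, and a value 1 is symmetric
    too. *)
Lemma form_fixed x y : twist M y = y -> B x y = f (B y x).
Proof. by move=> ty; rewrite -form_twist ty. Qed.

(* If [B v w0 = 1] then [twist w0 - w0] is orthogonal to [v], so [w0] can be   *)
(* made fixed by adding a vector orthogonal to [v]; then [w0 + c *: v] is      *)
(* isotropic as soon as [c ^+ q + c = - B w0 w0], which forces                 *)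
(* [c ^+ (q * q) = c].                                                         *)
Lemma hyperbolic_partner (P : 'rV[K]_n -> Prop) v u :
    P 0 -> (forall c x y, P x -> P y -> P (c *: x + y)) ->
    (forall x, P x -> P (twist M x)) ->
    P v -> P u -> twist M v = v -> B v v = 0 -> B v u != 0 ->
  exists w, [/\ P w, twist M w = w, B v w = 1 & B w w = 0].
Proof.
move=> P0 PZD Pt Pv Pu tv vv vu0.
have PZ c x : P x -> P (c *: x) by move=> Px; rewrite -[c *: x]addr0; apply: PZD.
have [w0 Pw0 vw0] : exists2 w0, P w0 & B v w0 = 1.
  by exists ((B v u)^-1 *: u); [apply: PZ | rewrite formZr mulVf].
have fixv x : B x v = f (B v x) by apply: form_fixed.
pose P' x := P x /\ B v x = 0.
have Q0 : (q * q)%:R = 0 :> K by rewrite natrM q0 mul0r.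
have [||||t [Put vt] tt] :=
  @lang_surjective K _ _ _ P' (w0 - twist M w0) Q0 twistD twistZ.
- by split; rewrite ?formE.
- move=> c x y [Px vx] [Py vy]; split; first exact: PZD.
  by rewrite !formE vx vy mulr0 addr0.
- by move=> x [Px vx]; split; [apply: Pt | rewrite form_twist fixv vx !rmorph0].
- have PB x y : P x -> P y -> P (x - y).
    by move=> Px Py; rewrite addrC -scaleN1r; apply: PZD.
  split; first by apply: PB => //; apply: Pt.
  by rewrite -scaleN1r !formE form_twist fixv vw0 !rmorph1 mulN1r subrr.
pose w1 := w0 + t.
have Pw1 : P w1 by rewrite /w1 -[w0]scale1r; apply: PZD.
have tw1 : twist M w1 = w1 by rewrite twistD tt addrCA [twist _ _ + _]addrC subrK addrC.
have vw1 : B v w1 = 1 by rewrite formE vw0 vt addr0.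
clearbody w1.
have fb : f (B w1 w1) = B w1 w1 by rewrite -form_fixed.
have [|c] := @separable_root K (- ('X ^+ q + 'X + (B w1 w1)%:P)).
  by rewrite derivN !derivD derivX derivC deriv_exp_pchar // add0r addr0.
rewrite /root !hornerE oppr_eq0 -fE => /eqP Dc.
have ffc : c ^+ (q * q) = c.
  have fc : f c = - c - B w1 w1.
    by apply/eqP; rewrite -subr_eq0 opprB opprK addrA addrAC Dc.
  by rewrite exprM -!fE fc rmorphB rmorphN fc fb opprB opprK addrAC subrr add0r.
exists (w1 + c *: v); split.
- by rewrite addrC; apply: PZD.
- by rewrite twistD twistZ ffc tv tw1.
- by rewrite !formE vw1 vv mulr0 addr0.
- by rewrite !formE vv fixv vw1 rmorph1 !mulr1 !mulr0 addr0 -Dc; ring.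
Qed.
End Form.

(** * Orthogonality in dimension four and hyperbolic frames *)

Section Space.
Variables (M : 'M[K]_4) (Mu : M \in unitmx).
Local Notation B := (frob_form M).
Implicit Types a b c u v w x y z : 'rV[K]_4.

Lemma form_row m n (A : 'M_(m, 4)) (A' : 'M_(n, 4)) i j :
  B (row i A) (row j A') = (map_mx f A *m M *m A'^T) i j.
Proof. by rewrite /frob_form map_row -!row_mul tr_row colE mulmxA -colE !mxE. Qed.

Lemma form_perp m (A : 'M_(m, 4)) z :
  (forall i, B (row i A) z = 0) <-> (z <= kermx (map_mx f A *m M)^T)%MS.
Proof.
have E i : B (row i A) z = (z *m (map_mx f A *m M)^T) 0 i.
  by rewrite -[in LHS](row_id 0 z) form_row -[_ *m z^T]trmxK trmx_mul trmxK mxE.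
split=> [Az|/sub_kermxP Az i]; last by rewrite E Az mxE.
by apply/sub_kermxP/rowP => i; rewrite -E Az mxE.
Qed.

Lemma rank_kermx_form m (A : 'M_(m, 4)) :
  \rank (kermx (map_mx f A *m M)^T) = (4 - \rank A)%N.
Proof. by rewrite mxrank_ker mxrank_tr mxrankMfree ?row_free_unit // mxrank_map. Qed.

Definition rows3 a b c : 'M_(3, 4) := \matrix_i [:: a; b; c]`_i.

Lemma rows3P a b c z :
  (forall i, B (row i (rows3 a b c)) z = 0) <->
  [/\ B a z = 0, B b z = 0 & B c z = 0].
Proof.
split=> [h|[ha hb hc] [[|[|[|//]]] hi]]; rewrite ?rowK //.
by split; [have := h 0|have := h 1|have := h (2 : 'I_3)]; rewrite rowK.
Qed.

Lemma exists_perp3 a b c :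
  exists2 z, z != 0 & [/\ B a z = 0, B b z = 0 & B c z = 0].
Proof.
have : kermx (map_mx f (rows3 a b c) *m M)^T != 0.
  rewrite -mxrank_eq0 rank_kermx_form subn_eq0 -ltnNge.
  exact: leq_ltn_trans (rank_leq_row _) _.
by case/rowV0Pn=> z /form_perp/rows3P hz z0; exists z.
Qed.

(** [M] is invertible and [f] preserves rank, so three independent vectors impose independent
    conditions. This is the tool for showing that [twist M v] is proportional to [v]. *)
Lemma perp3_line a b c v z : free [:: a; b; c] -> v != 0 ->
    [/\ B a v = 0, B b v = 0 & B c v = 0] ->
    [/\ B a z = 0, B b z = 0 & B c z = 0] ->
  exists t, z = t *: v.
Proof.
move=> abc v0 /rows3P/form_perp hv /rows3P/form_perp hz.
apply/sub_rVP/(submx_trans hz).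
rewrite -(mxrank_leqif_sup hv) rank_rV v0 rank_kermx_form.
suff /eqP-> : row_free (rows3 a b c) by [].
rewrite -kermx_eq0; apply/rowV0P => u /sub_kermxP.
rewrite mulmx_sum_row => hu; apply/rowP => i; rewrite mxE.
move/(@freeP _ _ _ [tuple a; b; c]): abc => /(_ (u 0)) -> //=.
by rewrite -[RHS]hu; apply: eq_bigr => j _; rewrite rowK.
Qed.

(* Two hyperbolic planes: [1] at (0, 1), (1, 0), (2, 3), (3, 2).               *)
Definition frame_form : 'M[K]_4 :=
  \matrix_(i, j) ((i + j == 1) || (i + j == 5))%N%:R.

Definition is_frame (g : 'M[K]_4) : Prop :=
  map_mx f g *m M *m g^T = frame_form.

Lemma frame_form_unit : frame_form \in unitmx.
Proof.
suff /mulmx1_unit[] : frame_form *m frame_form = 1%:M by [].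
apply/matrixP => i j; rewrite !mxE !big_ord_recl big_ord0 !mxE.
by case: i => [[|[|[|[|//]]]] hi]; case: j => [[|[|[|[|//]]]] hj];
  rewrite /= ?(mulr0, mul0r, mulr1, addr0, add0r).
Qed.

Lemma frame_unit g : is_frame g -> g \in unitmx.
Proof.
move=> Dg; have := frame_form_unit; rewrite -Dg unitmx_mul unitmx_tr.
by case/andP.
Qed.

(** For [a] anisotropic and [b] orthogonal to [v], [w], [a], the value of the form at [a + t *: b]
    is a polynomial in [t], of degree [q.+1] when [b] is anisotropic. At a root the vector is
    nonzero, since [B a (a + t *: b) = B a a]. *)
Lemma exists_isotropic_perp v w : exists2 x, x != 0 &
  [/\ B v x = 0, B w x = 0 & B x x = 0].
Proof.
have [a a0 [va wa _]] := exists_perp3 v w 0.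
have [aa|aa] := eqVneq (B a a) 0; first by exists a.
have [b b0 [vb wb ab]] := exists_perp3 v w a.
have [bb|bb] := eqVneq (B b b) 0; first by exists b.
pose P := (B b a *: 'X ^+ q + (B a a)%:P).
have sP : (size P < size (B b b *: 'X^(q.+1))%R)%N.
  rewrite size_scale // size_polyXn ltnS (leq_trans (size_polyD _ _)) // geq_max.
  rewrite (leq_trans (size_scale_leq _ _)) ?size_polyXn //.
  by rewrite (leq_trans (size_polyC_leq1 _)).
have /closed_rootP[t] : size (B b b *: 'X^(q.+1) + P) != 1.
  by rewrite size_polyDl // size_scale // size_polyXn; case: q q_gt1.
rewrite /root !hornerE -!fE exprSr -fE => /eqP Pt.
exists (a + t *: b).
  apply: contraNneq aa => abt.
  by have := formDr M a a (t *: b); rewrite abt form0r formZr ab mulr0 addr0 => <-.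
split; rewrite !formE ?va ?vb ?wa ?wb ?ab ?mulr0 ?addr0 //.
by rewrite -Pt /=; ring.
Qed.

Lemma exists_frame v : v != 0 -> twist M v = v -> B v v = 0 ->
  exists2 g, is_frame g & row 0 g = v.
Proof.
move=> v0 tv vv.
have fixB x y : twist M y = y -> B x y = f (B y x) by apply: form_fixed.
have [u vu] := form_nondegenerate Mu v0.
have [w [_ tw vw ww]] := hyperbolic_partner (P := fun=> True) Mu I
  (fun _ _ _ _ _ => I) (fun _ _ => I) I (I : (fun=> True) u) tv vv vu.
have wv : B w v = 1 by rewrite fixB // vw rmorph1.
pose W z := B v z = 0 /\ B w z = 0.
have W0 : W 0 by rewrite /W !formE.
have WZD (t : K) x y : W x -> W y -> W (t *: x + y).
  by rewrite /W !formE => -[-> ->] [-> ->]; rewrite mulr0 addr0.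
have Wtwist x : W x -> W (twist M x).
  by case=> vx wx; rewrite /W !form_twist // (fixB x v) // (fixB x w) // vx wx !rmorph0.
have [x [x0 vx wx xx tx]] : exists x,
    [/\ x != 0, B v x = 0, B w x = 0, B x x = 0 & twist M x = x].
  have [x x0 [vx wx xx]] := exists_isotropic_perp v w.
  (* Both [x] and [twist M x] are orthogonal to the independent vectors [v], [w], [x]. *)
  have [l tx] : exists l, twist M x = l *: x.
    have [vtx wtx] := Wtwist x (conj vx wx).
    apply: (@perp3_line v w x) => //; last first.
      by split=> //; rewrite form_twist // xx rmorph0.
    apply/(@freeP _ _ _ [tuple v; w; x]) => c.
    rewrite !big_ord_recl big_ord0 addr0 /= => Dc.
    have c1 : c (lift ord0 ord0) = 0.
      by have := form0r M v; rewrite -Dc !formE vv vw vx !mulr0 mulr1 add0r addr0.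
    have c0 : c ord0 = 0.
      by have := form0r M w; rewrite -Dc !formE ww wv wx !mulr0 mulr1 !addr0.
    move: Dc; rewrite c0 c1 !scale0r !add0r => /eqP.
    rewrite scaler_eq0 (negPf x0) orbF => /eqP c2 [[|[|[|//]]] hi].
    - by rewrite -c0; congr c; apply: val_inj.
    - by rewrite -c1; congr c; apply: val_inj.
    - by rewrite -c2; congr c; apply: val_inj.
  have [s s0 tsx] := twist_fixed_scale Mu x0 tx.
  exists (s *: x); rewrite !formE vx wx xx !mulr0 scaler_eq0 negb_or s0.
  by split.
have [z xz] := form_nondegenerate Mu x0.
have [y [[vy wy] ty xy yy]] : exists y, [/\ W y, twist M y = y, B x y = 1 & B y y = 0].
  (* The chosen [u] is the projection of [z] to the complement [W]; it pairs with [x] as [z]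
     does. *)
  apply: (hyperbolic_partner Mu (u := z - B v z *: w - B w z *: v)) => //.
    rewrite -!scaleNr /W !formE vw vv ww wv.
    by split; ring.
  by rewrite -!scaleNr !formE (fixB x w) // (fixB x v) // vx wx rmorph0 !mulr0 !addr0.
pose R (i : 'I_4) := [:: v; w; x; y]`_i.
pose g := \matrix_i R i; have gR i : row i g = R i by apply: rowK.
exists g; last exact: gR.
apply/matrixP => i j; rewrite -form_row !gR mxE.
have fixB1 a b : twist M b = b -> B b a = 1 -> B a b = 1.
  by move=> tb ba; rewrite fixB // ba rmorph1.
have fixB0 a b : twist M b = b -> B b a = 0 -> B a b = 0.
  by move=> tb ba; rewrite fixB // ba rmorph0.
rewrite /R; case: i => [[|[|[|[|//]]]] hi]; case: j => [[|[|[|[|//]]]] hj] //=;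
  by [apply: fixB0 | apply: fixB1].
Qed.

End Space.

(** * Lines and stars on the surface *)

Section Surface.
Variables (M : 'M[K]_4) (F : {mpoly K[4]}).
Hypotheses (Mu : M \in unitmx) (FE : forall v : 'rV[K]_4, F.@[v 0] = frob_form M v v).
Local Notation B := (frob_form M).
Implicit Types (U : {vspace 'rV[K]_4}) (g : 'M[K]_4).

(** Expanding the form at [u + t *: w] gives [E t] for every [t]. Taking [t = 1] makes the form
    alternate in sign, and a [t] with [f t - t = -1] then kills it. *)
Lemma on_surface_form U u w : on_surface F U -> u \in U -> w \in U -> B u w = 0.
Proof.
move=> FU uU wU; have BU x : x \in U -> B x x = 0 by rewrite -FE => /FU.
have E t : t * B u w + f t * B w u = 0.
  have := BU (u + t *: w); rewrite memvD ?memvZ // !formE !BU // => <- //.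
  by ring.
have [|t] := @separable_root K ('X ^+ q - 'X + 1).
  by rewrite derivD derivB derivX deriv_exp_pchar // derivC sub0r addr0.
rewrite /root !hornerE -fE => /eqP Dt.
have := E 1; rewrite rmorph1 !mul1r => /eqP; rewrite addr_eq0 => /eqP uw.
have := E t; rewrite uw mulrN addrC -mulrBl.
by rewrite -[f t - t](addrK 1) Dt sub0r mulN1r.
Qed.

(** The two lines are totally isotropic and span a 3-space; by adjunction [v] and [twist M v] are
    both orthogonal to it. *)
Lemma star_center_twist U1 U2 v : is_line U1 -> is_line U2 ->
    on_surface F U1 -> on_surface F U2 -> U1 != U2 ->
    v != 0 -> v \in U1 -> v \in U2 ->
  exists t, twist M v = t *: v.
Proof.
move=> dU1 dU2 FU1 FU2 U12 v0 vU1 vU2.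
have [u1 u1v DU1] := line_span dU1 v0 vU1.
have /subvPn[u2 u2U2 u2U1] : ~~ (U2 <= U1)%VS.
  by apply: contraNN U12 => U21; rewrite eq_sym eqEdim U21 dU1 dU2.
have u1U1 : u1 \in U1 by rewrite DU1 memvE addvSr.
apply: (@perp3_line M Mu u2 u1 v) => //.
- rewrite free_cons span_cons span_seq1 addvC -DU1 u2U1.
  by rewrite free_cons span_seq1 u1v seq1_free.
- by rewrite (on_surface_form FU2 u2U2) ?(on_surface_form FU1 _ vU1).
- rewrite !(form_twist Mu).
  by split; rewrite ?(on_surface_form FU2 vU2 u2U2) ?(on_surface_form FU1 vU1) ?rmorph0.
Qed.

(* With [rs] the roots of [r ^+ q + r] and [g] a frame, these are all the      *)
(* lines of the surface through [row 0 g].                                     *)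
Definition star_lines (rs : seq K) g : seq {vspace 'rV[K]_4} :=
  let line_to u := (<[row 0%R g]> + <[u]>)%VS in
  line_to (row 2 g) :: [seq line_to (r *: row 2 g + row 3 g) | r <- rs].

Lemma frameE g i j : is_frame M g ->
  B (row i g) (row j g) = ((i + j == 1) || (i + j == 5))%N%:R.
Proof. by move=> Dg; rewrite form_row Dg mxE. Qed.

(** In frame coordinates (a, b, c, d) of a second vector [u] of the line, [B (row 0 g) u = 0] gives
    [b = 0], and [B u u = 0] says that [d = 0] or that [c / d] is a root of [r ^+ q + r]. *)
Lemma mem_star_lines rs g U : is_frame M g ->
    (forall r, r ^+ q + r = 0 -> r \in rs) ->
    is_line U -> on_surface F U -> row 0 g \in U ->
  U \in star_lines rs g.
Proof.
move=> Dg rsP dU FU vU; have gu := frame_unit Dg.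
have v0 : row 0 g != 0.
  apply/eqP => g0; have := frameE 0 1 Dg.
  by rewrite g0 form0l => /eqP; rewrite eq_sym oner_eq0.
have [u uv DU] := line_span dU v0 vU.
have uU : u \in U by rewrite DU memvE addvSr.
have [a [b [c [d Du]]]] : exists a b c d : K,
    u = a *: row 0 g + (b *: row 1 g + (c *: row 2 g + d *: row 3 g)).
  have E1 : lift ord0 (ord0 : 'I_3) = 1 by apply: val_inj.
  have E2 : lift ord0 (lift ord0 (ord0 : 'I_2)) = 2 by apply: val_inj.
  have E3 : lift ord0 (lift ord0 (lift ord0 (ord0 : 'I_1))) = 3 by apply: val_inj.
  have := mulmx_sum_row (u *m invmx g) g.
  rewrite mulmxKV // !big_ord_recl big_ord0 addr0 E1 E2 E3 => Du.
  by do 4!eexists; apply: Du.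
have b0 : b = 0.
  have := on_surface_form FU vU uU.
  by rewrite Du !formE !(frameE _ _ Dg) /= !mulr0 mulr1 !addr0 add0r.
have cd : f c * d + f d * c = 0.
  have := on_surface_form FU uU uU.
  rewrite Du b0 !formE !(frameE _ _ Dg) /= rmorph0 => <-.
  by ring.
have [d0|d0] := eqVneq d 0.
  have c0 : c != 0.
    apply: contraNneq uv => c0.
    by rewrite Du b0 c0 d0 !scale0r !addr0 memvZ ?memv_line.
  by rewrite DU Du b0 d0 !scale0r addr0 add0r addv_line_shift ?mem_head.
have Du' : u = a *: row 0 g + d *: ((c / d) *: row 2 g + row 3 g).
  by rewrite Du b0 scale0r add0r scalerDr scalerA mulrCA divff // mulr1.
rewrite DU Du' addv_line_shift // inE; apply/orP; right.
apply/mapP; exists (c / d) => //; apply: rsP.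
rewrite -fE fmorph_div; have fd0 : f d != 0 by rewrite fmorph_eq0.
apply: (mulIf (mulf_neq0 fd0 d0)); rewrite mul0r -cd.
by field; apply/andP.
Qed.

Lemma proj_act_star_lines rs g h : g \in unitmx ->
  map (proj_act (invmx g *m h)) (star_lines rs g) = star_lines rs h.
Proof.
move=> gu; have gh i : row i g *m (invmx g *m h) = row i h.
  by rewrite -row_mul mulmxA mulmxV // mul1mx.
rewrite /star_lines /= /proj_act limgD !limg_line !lfunE /= !gh; congr (_ :: _).
rewrite -map_comp; apply: eq_map => r /=.
by rewrite limgD !limg_line !lfunE /= mulmxDl -scalemxAl !gh.
Qed.

Lemma star_linesP rs (S : {fset {vspace 'rV[K]_4}}) :
    size rs = q -> (forall r, r ^+ q + r = 0 -> r \in rs) ->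
    is_star q.+1 F S ->
  exists2 g, is_frame M g & S =i star_lines rs g.
Proof.
move=> sz_rs rsP [cS SP [P [dP PS]]].
have Pn0 : vpick P != 0 by rewrite vpick0 -dimv_eq0 dP.
have PU U : U \in S -> vpick P \in U by move=> /PS/subvP; apply; apply: memv_pick.
have [U1 [U2 [U1S U2S U12]]] : exists U1 U2, [/\ U1 \in S, U2 \in S & U1 != U2].
  have memS U : (U \in S) = (U \in enum_fset S) by [].
  move: cS (fset_uniq S) memS; case: (enum_fset S) => [|U1 [|U2 s]] //=.
    by case: q q_gt1 => [|[]].
  rewrite inE negb_or => _ /andP[/andP[U12 _] _] memS.
  by exists U1, U2; rewrite !memS !inE !eqxx orbT.
have [dU1 FU1] := SP _ U1S; have [dU2 FU2] := SP _ U2S.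
have [t tv] := star_center_twist dU1 dU2 FU1 FU2 U12 Pn0 (PU _ U1S) (PU _ U2S).
have [c c0 tcv] := twist_fixed_scale Mu Pn0 tv.
have cPU U : U \in S -> c *: vpick P \in U by move=> /PU; apply: memvZ.
have [||g Dg g0] := exists_frame Mu _ tcv; first by rewrite scaler_eq0 negb_or c0.
  by rewrite (on_surface_form FU1) ?cPU.
exists g => //.
(* The star has [q.+1] distinct lines inside a list of length [q.+1], so it exhausts the list. *)
have [|||_ //] := @uniq_min_size _ (enum_fset S) (star_lines rs g).
- exact: fset_uniq.
- by move=> U US; have [dU FU] := SP _ US; apply: mem_star_lines; rewrite // g0 cPU.
- by rewrite /= size_map sz_rs cS.
Qed.

Lemma congruence_surface_aut (A : 'M[K]_4) : A \in unitmx ->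
  map_mx f A *m M *m A^T = M -> surface_aut F A.
Proof.
move=> Au AM; split=> // P _.
have FA (v : 'rV_4) : F.@[(v *m A) 0] = F.@[v 0].
  by rewrite !FE /frob_form map_mxM trmx_mul -!mulmxA (mulmxA _ M) (mulmxA _ _ v^T) AM.
split=> FP v vP.
  by rewrite -FA; apply: FP; rewrite -[v *m A](lfunE (mulmxr A)) memv_img.
by case/memv_imgP: vP => u uP ->; rewrite lfunE FA; apply: FP.
Qed.
End Surface.
End FrobeniusForm.

(** * The projective action on subspaces and stars *)

Section ProjAct.
Variable K : fieldType.
Implicit Types (A : 'M[K]_4) (U : {vspace 'rV[K]_4}).

Lemma proj_actM A A' U : proj_act A' (proj_act A U) = proj_act (A *m A') U.
Proof.
rewrite /proj_act -limg_comp; congr (_ @: _)%VS; apply/lfunP => x.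
by rewrite comp_lfunE !lfunE /= mulmxA.
Qed.

Lemma proj_act1 U : proj_act 1%:M U = U.
Proof.
rewrite /proj_act -[RHS]lim1g; congr (_ @: _)%VS; apply/lfunP => x.
by rewrite !lfunE /= mulmx1.
Qed.

Lemma proj_actK A : A \in unitmx -> cancel (proj_act A) (proj_act (invmx A)).
Proof. by move=> Au U; rewrite proj_actM mulmxV // proj_act1. Qed.

Lemma dim_proj_act A U : A \in unitmx -> \dim (proj_act A U) = \dim U.
Proof.
move=> Au; apply: limg_dim_eq; apply/eqP; rewrite -subv0.
apply: subv_trans (capvSr _ _) _; rewrite subv0; apply/lker0P => x y.
by rewrite !lfunE /=; apply: (can_inj (mulmxK Au)).
Qed.

Lemma surface_aut_on_surface F A U :
  surface_aut F A -> on_surface F U -> on_surface F (proj_act A U).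
Proof.
move=> [_ FA] FU _ /memv_imgP[u uU ->]; rewrite lfunE /=.
have [->|u0] := eqVneq u 0; first by rewrite mul0mx; apply/FU/mem0v.
have du : is_point <[u]>%VS by rewrite /is_point dim_vline u0.
apply: ((FA _ du).2 _ (u *m A)).
  by move=> w /vlineP[t ->]; apply/FU/memvZ.
by rewrite /proj_act limg_line lfunE memv_line.
Qed.

Lemma surface_aut_star F A d S :
  surface_aut F A -> is_star d F S -> is_star d F (star_act A S).
Proof.
move=> FA [cS SP [P [dP PS]]]; have Au := FA.1; split.
- by rewrite card_imfset //; apply: can_inj (proj_actK Au).
- move=> _ /imfsetP[U US ->]; have [dU FU] := SP _ US.
  by split; [rewrite /is_line dim_proj_act | apply: surface_aut_on_surface].
- exists (proj_act A P); split; first by rewrite /is_point dim_proj_act.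
  by move=> _ /imfsetP[U US ->]; apply/limgS/PS.
Qed.
End ProjAct.

(** * From the polynomial to its matrix, and transitivity *)

Lemma Frobenius_form_matrix (K : closedFieldType) (q : nat) (f : {rmorphism K -> K})
    (F : {mpoly K[4]}) :
    (forall x, f x = x ^+ q) -> q%:R = 0 :> K -> Frobenius_form q F ->
  exists M : 'M[K]_4, forall v : 'rV[K]_4,
    F.@[v 0] = frob_form f M v v /\
    forall j, F^`M(j).@[v 0] = (map_mx f v *m M) 0 j.
Proof.
move=> fE q0 [L [hL ->]]; exists (\matrix_(i, j) (L i)@_U_(j)) => v; split.
  rewrite /frob_form -mulmxA !mxE raddf_sum; apply: eq_bigr => i _ /=.
  rewrite mevalM rmorphXn /= mevalXU !mxE fE; congr (_ * _).
  rewrite {1}(homog1E (hL i)) raddf_sum; apply: eq_bigr => j _ /=.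
  by rewrite mevalZ mevalXU !mxE.
move=> j; rewrite !mxE (big_morph _ (mderivD j) (mderiv0 _ j)) raddf_sum.
(* Since [q] vanishes in [K], the powers ['X_i ^+ q] have zero derivative and only the linear forms
   are differentiated. *)
apply: eq_bigr => i _ /=; rewrite mderivM mpolyXn mderivX mulmnE natrM q0 mulr0 scale0r mul0r add0r.
rewrite mevalM -mpolyXn rmorphXn /= mevalXU !mxE fE; congr (_ * _).
by rewrite mderiv_homog1 // mevalC.
Qed.

(** If [y *m M = 0] with [y] nonzero, the vector of [q]-th roots of the entries of [y] is a singular
    point. *)
Lemma smooth_surface_unit (K : closedFieldType) (q : nat) (f : {rmorphism K -> K})
    (F : {mpoly K[4]}) (M : 'M[K]_4) :
    (forall x, f x = x ^+ q) -> (0 < q)%N ->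
    (forall v : 'rV[K]_4, F.@[v 0] = frob_form f M v v /\
      forall j, F^`M(j).@[v 0] = (map_mx f v *m M) 0 j) ->
    smooth_surface F ->
  M \in unitmx.
Proof.
move=> fE q_gt0 FM FX; rewrite -row_free_unit -kermx_eq0.
apply: contraT => /rowV0Pn[y /sub_kermxP yM y0].
have [h hy] := fin_all_exists (fun i => nth_root_exists (y 0 i) q_gt0).
pose v := \row_i h i.
have vy : map_mx f v = y by apply/rowP => i; rewrite !mxE fE hy.
have v0 : v != 0 by rewrite -(map_mx_eq0 f) vy.
have [Fv dFv] := FM v; have [|j] := FX v v0.
  by rewrite Fv /frob_form vy yM mul0mx mxE.
by rewrite dFv vy yM mxE eqxx.
Qed.

Theorem proposition3p1p1 (k : closedFieldType) (p e : nat)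
    (hp : p \in [pchar k]) (he : (1 <= e)%N)
    (F : {mpoly k[4]})
    (hF : Frobenius_form (p ^ e)%N F) (hX : smooth_surface F) :
  (forall (A : 'M[k]_4) (S : {fset {vspace 'rV[k]_4}}),
      surface_aut F A -> is_star (p ^ e).+1 F S ->
      is_star (p ^ e).+1 F (star_act A S)) /\
  (forall S T : {fset {vspace 'rV[k]_4}},
      is_star (p ^ e).+1 F S -> is_star (p ^ e).+1 F T ->
      exists A : 'M[k]_4, surface_aut F A /\ star_act A S = T).
Proof.
split=> [A S|S T starS starT]; first exact: surface_aut_star.
have [f fE] := frobenius_rmorphism e hp.
have q_gt1 : (1 < p ^ e)%N.
  by rewrite -(exp1n e) ltn_exp2r // prime_gt1 // (pcharf_prime hp).
have q0 : (p ^ e)%:R = 0 :> k by rewrite natrX (pcharf0 hp) expr0n eqn0Ngt he.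
have [M FM] := Frobenius_form_matrix fE q0 hF.
have Mu := smooth_surface_unit fE (ltnW q_gt1) FM hX.
have FE v := (FM v).1.
have [rs sz_rs rsP] := roots_XnDX k q_gt1.
have [g Dg Sg] := star_linesP fE q_gt1 q0 Mu FE sz_rs rsP starS.
have [h Dh Th] := star_linesP fE q_gt1 q0 Mu FE sz_rs rsP starT.
have gu := frame_unit Dg; have hu := frame_unit Dh.
exists (invmx g *m h); split.
  apply: (congruence_surface_aut FE); first by rewrite unitmx_mul unitmx_inv gu.
  (* The Gram matrix of [h] is replaced by the equal one of [g], which cancels against [invmx g]. *)
  have -> : map_mx f (invmx g *m h) *m M *m (invmx g *m h)^T =
      map_mx f (invmx g) *m (map_mx f h *m M *m h^T) *m (invmx g)^T.
    by rewrite map_mxM trmx_mul !mulmxA.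
  rewrite Dh -Dg map_invmx !mulmxA mulVmx ?map_unitmx // mul1mx.
  by rewrite -mulmxA -trmx_mul mulVmx // trmx1 mulmx1.
apply/fsetP => U; rewrite Th -(proj_act_star_lines rs h gu).
apply/imfsetP/mapP => -[V VS ->]; exists V => //.
  by rewrite -Sg.
by rewrite /= Sg.
Qed.
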